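(* $\mathrm{FO}^2$ and $\mathrm{GRA}(e,s,\neg,\dot\cap,\exists)$ are sententially equiexpressive over vocabularies with at most binary relations; that is, when only relation symbols of arity at most $2$ are used, every sentence of $\mathrm{FO}^2$ has an equivalent term of $\mathrm{GRA}(e,s,\neg,\dot\cap,\exists)$, and every term of $\mathrm{GRA}(e,s,\neg,\dot\cap,\exists)$ of arity $0$ has an equivalent sentence of $\mathrm{FO}^2$.
   Context: AD-relations. $A^0=\{\epsilon\}$, with $\epsilon$ the empty tuple. A $k$-ary AD-relation over a set $A$ is a pair $(R,k)$ with $R\subseteq A^k$, $k\ge 0$; $t\in(R,k)$ means $t\in R$. Vocabularies contain only relation symbols (arity $\ge 0$). Models have nonempty domains; $A$ is the domain of $\mathfrak{A}$. Terms. $\mathrm{GRA}(e,s,\neg,\dot\cap,\exists)$ is the set of terms built from relation symbols and the constant $e$ by the unary operators $s,\neg,\exists$ and the binary operator $\dot\cap$. Each term $\mathcal{T}$ defines in each model $\mathfrak{A}$ an AD-relation $\mathcal{T}^{\mathfrak{A}}$ of arity $\mathit{ar}(\mathcal{T})$. Let $k=\mathit{ar}(\mathcal{T})$, $\ell=\mathit{ar}(\mathcal{S})$, $m=\max\{k,\ell\}$. - $R^{\mathfrak{A}}$ is the interpretation of $R$, paired with the arity of $R$; $e^{\mathfrak{A}}=(\{(a,a)\mid a\in A\},2)$. - If $k\ge2$: $(s\mathcal{T})^{\mathfrak{A}}=(\{(a_1,\dots,a_{k-2},a_k,a_{k-1})\mid(a_1,\dots,a_k)\in\mathcal{T}^{\mathfrak{A}}\},k)$;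 if $k\le1$: $(s\mathcal{T})^{\mathfrak{A}}=\mathcal{T}^{\mathfrak{A}}$. - $(\neg\mathcal{T})^{\mathfrak{A}}=(\{t\in A^k\mid t\notin\mathcal{T}^{\mathfrak{A}}\},k)$. - Suffix intersection: $(\mathcal{T}\,\dot\cap\,\mathcal{S})^{\mathfrak{A}}=(\{(a_1,\dots,a_m)\in A^m\mid(a_{m-k+1},\dots,a_m)\in\mathcal{T}^{\mathfrak{A}}\text{ and }(a_{m-\ell+1},\dots,a_m)\in\mathcal{S}^{\mathfrak{A}}\},m)$, where $(a_{m+1},a_m)$ denotes $\epsilon$. - If $k\ge1$: $(\exists\mathcal{T})^{\mathfrak{A}}=(\{(a_1,\dots,a_{k-1})\mid(a_1,\dots,a_k)\in\mathcal{T}^{\mathfrak{A}}\text{ for some }a_k\in A\},k-1)$; if $k=0$: $(\exists\mathcal{T})^{\mathfrak{A}}=\mathcal{T}^{\mathfrak{A}}$. Formulas. $\mathrm{FO}^2$ is the fragment of first-order logic with equality (over relation symbols) in which only two variable symbols $x,y$ are allowed. A sentence $\varphi$ defines the $0$-ary AD-relation $\varphi^{\mathfrak{A}}=(\{\epsilon\},0)$ if $\mathfrak{A}\models\varphi$ and $(\varnothing,0)$ otherwise. A sentence $\varphi$ and a term $\mathcal{T}$ are equivalent if $\varphi^{\mathfrak{A}}=\mathcal{T}^{\mathfrak{A}}$ for every model $\mathfrak{A}$ whose vocabulary contains all symbols of $\varphi$ and $\mathcal{T}$. *)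

(* Defs.v *)
From HB Require Import structures.
From mathcomp Require Import all_boot.
From mathcomp Require Import boolp classical_sets.

Set Implicit Arguments.
Unset Strict Implicit.
Unset Printing Implicit Defensive.

Local Open Scope classical_set_scope.

Record vocabulary := Vocabulary {
  sym :> Type;
  arity : sym -> nat
}.

Record model (V : vocabulary) := Model {
  dom :> Type;
  dom_nonempty : inhabited dom;
  interp : forall R : V, set ((arity R).-tuple dom)
}.
Arguments interp {V} m R.

(* The arity is part of the data: the empty relations of different arities
   are distinct AD-relations. *)
Record adrel (A : Type) := ADRel {
  ad_arity : nat;
  ad_set : set (ad_arity.-tuple A)
}.

Section Operators.
Variable A : Type.

Definition eq_rel : set (2.-tuple A) :=
  [set t | exists a, t = [tuple a; a]].

Definition swap_rel (k : nat) : set (k.-tuple A) -> set (k.-tuple A) :=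
  match k return set (k.-tuple A) -> set (k.-tuple A) with
  | k'.+2 => fun T =>
      [set t | exists (u : k'.-tuple A) (a b : A),
         T [tuple of rcons (rcons u a) b] /\
         t = [tuple of rcons (rcons u b) a]]
  | _ => fun T => T
  end.

Definition neg_rel (k : nat) (T : set (k.-tuple A)) : set (k.-tuple A) := ~` T.

(* [drop (m - k) t] is (a_(m-k+1), ..., a_m) for t = (a_1, ..., a_m). *)
Definition suffix_in (k m : nat) (T : set (k.-tuple A)) (t : m.-tuple A) :=
  exists2 u : k.-tuple A, T u & tval u = drop (m - k) t.

Definition suffix_cap (k l : nat) (T : set (k.-tuple A)) (S : set (l.-tuple A)) :
    set ((maxn k l).-tuple A) :=
  [set t | suffix_in T t /\ suffix_in S t].

Definition proj_rel (k : nat) : set (k.-tuple A) -> set (k.-1.-tuple A) :=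
  match k return set (k.-tuple A) -> set (k.-1.-tuple A) with
  | 0 => fun T => T
  | k'.+1 => fun T => [set t : k'.-tuple A | exists a : A, T [tuple of rcons t a]]
  end.

End Operators.

Inductive gra (V : vocabulary) : Type :=
| GSym of V
| GEq
| GSwap of gra V
| GNeg of gra V
| GCap of gra V & gra V
| GEx of gra V.

Arguments GEq {V}.

Fixpoint ar (V : vocabulary) (T : gra V) : nat :=
  match T with
  | GSym R => arity R
  | GEq => 2
  | GSwap T => ar T
  | GNeg T => ar T
  | GCap T1 T2 => maxn (ar T1) (ar T2)
  | GEx T => (ar T).-1
  end.

Fixpoint gra_set (V : vocabulary) (M : model V) (T : gra V) :
    set ((ar T).-tuple M) :=
  match T return set ((ar T).-tuple M) with
  | GSym R => interp M R
  | GEq => @eq_rel M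
  | GSwap T => swap_rel (@gra_set V M T)
  | GNeg T => neg_rel (@gra_set V M T)
  | GCap T1 T2 => suffix_cap (@gra_set V M T1) (@gra_set V M T2)
  | GEx T => proj_rel (@gra_set V M T)
  end.
Arguments gra_set {V} M T.

Definition gra_rel (V : vocabulary) (M : model V) (T : gra V) : adrel M :=
  ADRel (gra_set M T).

Section FirstOrder.
Variables (V : vocabulary) (X : eqType).

Inductive fo : Type :=
| FAtom (R : V) of (arity R).-tuple X
| FEq of X & X
| FNot of fo
| FAnd of fo & fo
| FOr of fo & fo
| FImp of fo & fo
| FEx of X & fo
| FAll of X & fo.

Fixpoint free (v : X) (phi : fo) : bool :=
  match phi with
  | FAtom _ t => v \in tval t
  | FEq w z => (v == w) || (v == z)
  | FNot p => free v p
  | FAnd p q | FOr p q | FImp p q => free v p || free v q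
  | FEx w p | FAll w p => (v != w) && free v p
  end.

Definition sentence (phi : fo) : Prop := forall v : X, ~~ free v phi.

Definition update (A : Type) (s : X -> A) (v : X) (a : A) : X -> A :=
  fun w => if w == v then a else s w.

Fixpoint sat (M : model V) (s : X -> M) (phi : fo) : Prop :=
  match phi with
  | FAtom R t => interp M R [tuple of map s t]
  | FEq v w => s v = s w
  | FNot p => ~ sat s p
  | FAnd p q => sat s p /\ sat s q
  | FOr p q => sat s p \/ sat s q
  | FImp p q => sat s p -> sat s q
  | FEx v p => exists a : M, sat (update s v a) p
  | FAll v p => forall a : M, sat (update s v a) p
  end.

(* Only used for sentences, whose truth value does not depend on [s];
   assignments exist since the domain is nonempty. *)
Definition models (M : model V) (phi : fo) : Prop :=
  forall s : X -> M, sat s phi.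

Definition fo_rel (M : model V) (phi : fo) : adrel M :=
  @ADRel M 0 (if `[< models M phi >] then [set [tuple]] else set0).

(* A model over a larger vocabulary enters only through its reduct to V, so it
   is enough to quantify over the models of V. *)
Definition equivalent (phi : fo) (T : gra V) : Prop :=
  forall M : model V, fo_rel M phi = gra_rel M T.

End FirstOrder.

Arguments FAtom {V X} R _.

(* The two variable symbols x and y are the two booleans. *)
Definition FO2 (V : vocabulary) : Type := fo V bool.

(* Main.v *)
(* Both directions rest on a uniform translation in the presence of two
   coordinates.  A formula phi(x, y) becomes a binary term, true of (s x, s y)
   exactly when s satisfies phi: a term of smaller arity is padded to arity 2
   by suffix intersection with the full binary relation, and the swap operator
   moves the coordinate to be bound into last position.  Conversely, a term is
   read as a formula about a suffix of the pair of variables (~~ b, b), and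
   projecting the last coordinate away exchanges the roles of the variables. *)
Require Import Defs.
From mathcomp Require Import all_boot.
From mathcomp Require Import boolp classical_sets.

Set Implicit Arguments.
Unset Strict Implicit.
Unset Printing Implicit Defensive.

(* Lists instead of tuples, so that equations between arities need no casts. *)
Definition member (A : Type) (k : nat) (T : set (k.-tuple A)) (l : seq A) :=
  exists2 u : k.-tuple A, T u & tval u = l.

Notation holds M T l := (member (gra_set M T) l).

(** * The relation operators on lists *)

Section Member.
Variable A : Type.

Lemma member_tval k (T : set (k.-tuple A)) (t : k.-tuple A) :
  member T (tval t) <-> T t.
Proof. by split=> [[u Tu /val_inj <-]|Tt] //; exists t. Qed.

Lemma member_eq_rel (a b : A) : member (@eq_rel A) [:: a; b] <-> a = b.
Proof.
split=> [[_ [c ->] /= [<- <-]] //|<-].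
by exists [tuple a; a] => //; exists a.
Qed.

(** Exchanging two entries is its own inverse, so the image of [T] is also its preimage. *)
Lemma member_swap_rel k (T : set (k.-tuple A)) l a b : 1 < k ->
  member (swap_rel T) (rcons (rcons l a) b) <->
  member T (rcons (rcons l b) a).
Proof.
case: k T => [|[|k]] T // _; split.
  case=> _ [u [c [d [Tu ->]]]] /= /rcons_inj[/rcons_inj[<- <-] <-].
  by exists [tuple of rcons (rcons u c) d].
case=> u Tu Eu; have sl : size l == k.
  by have := congr1 size Eu; rewrite size_tuple !size_rcons => -[->].
exists [tuple of rcons (rcons (Tuple sl) a) b] => //.
exists (Tuple sl), b, a; split=> //.
by have -> : [tuple of rcons (rcons (Tuple sl) b) a] = u by apply: val_inj.
Qed.

Lemma swap_rel_small k (T : set (k.-tuple A)) : k <= 1 -> swap_rel T = T.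
Proof. by case: k T => [|[|k]]. Qed.

Lemma member_neg_rel k (T : set (k.-tuple A)) l : size l = k ->
  member (neg_rel T) l <-> ~ member T l.
Proof.
move=> sl; rewrite -[l]/(tval (Tuple (introT eqP sl))).
by rewrite !member_tval.
Qed.

Lemma member_suffix_cap k l (T : set (k.-tuple A)) (S : set (l.-tuple A)) r :
  size r = maxn k l ->
  member (suffix_cap T S) r <->
  member T (drop (size r - k) r) /\ member S (drop (size r - l) r).
Proof.
move=> sr; rewrite sr -[r]/(tval (Tuple (introT eqP sr))).
by rewrite member_tval.
Qed.

Lemma member_proj_rel k (T : set (k.-tuple A)) l : 0 < k ->
  member (proj_rel T) l <-> exists a, member T (rcons l a).
Proof.
case: k T => [|k] T // _; split.
  by case=> t [a Ta] <-; exists a, [tuple of rcons t a].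
case=> a [u Tu Eu]; have sl : size l == k.
  by have := congr1 size Eu; rewrite size_tuple !size_rcons => -[->].
exists (Tuple sl) => //; exists a.
by have -> : [tuple of rcons (Tuple sl) a] = u by apply: val_inj.
Qed.

Lemma proj_rel0 k (T : set (k.-tuple A)) l : k = 0 ->
  member (proj_rel T) l <-> member T l.
Proof. by case: k T. Qed.

(** The arity of a term is only provably 0, so the two sets have different types until [k] is
    substituted; after that the empty tuple is the only one to test. *)
Lemma eq_adrel0 (P : Prop) k (T : set (k.-tuple A)) : k = 0 ->
  (P <-> member T [::]) ->
  @ADRel A 0 (if `[< P >] then [set [tuple]]%classic else set0) = ADRel T.
Proof.
move=> k0; subst k; have := member_tval T [tuple] => /= -> PT.
congr ADRel; apply/seteqP; split=> t; rewrite [t]tuple0; case: asboolP => //.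
- by move=> /PT.
- by move=> nP /PT.
Qed.

End Member.

(** * Satisfaction and free variables *)

Section SatFree.
Variables (V : vocabulary) (X : eqType) (M : model V).

(** Coincidence lemma. It also allows pointwise equal assignments to be exchanged. *)
Lemma eq_sat_free (phi : fo V X) (s s' : X -> M) :
  (forall v, free v phi -> s v = s' v) -> sat s phi <-> sat s' phi.
Proof.
have upd w (p : fo V X) (r r' : X -> M) a :
    (forall v, (v != w) && free v p -> r v = r' v) ->
    forall v, free v p -> update r w a v = update r' w a v.
  by move=> E v fv; rewrite /update; case: eqVneq => // vw; apply: E; rewrite vw.
elim: phi s s' => [R t|v w|p IHp|p IHp q IHq|p IHp q IHq|p IHp q IHq|w p IHp|w p IHp]
  s s' /= E.
- suff -> : [tuple of map s t] = [tuple of map s' t] by [].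
  by apply: val_inj; apply/eq_in_map => v; apply: E.
- by rewrite !E ?eqxx ?orbT.
- by rewrite (IHp s s').
- by rewrite (IHp s s') ?(IHq s s') // => v fv; apply: E; rewrite fv ?orbT.
- by rewrite (IHp s s') ?(IHq s s') // => v fv; apply: E; rewrite fv ?orbT.
- by rewrite (IHp s s') ?(IHq s s') // => v fv; apply: E; rewrite fv ?orbT.
- have Ea a := IHp _ _ (upd w p s s' a E).
  by split=> -[a Ha]; exists a; apply/Ea.
- have Ea a := IHp _ _ (upd w p s s' a E).
  by split=> H a; apply/Ea.
Qed.

Lemma sat_sentence (phi : fo V X) (s s' : X -> M) :
  sentence phi -> sat s phi -> sat s' phi.
Proof.
by move=> phi0; apply: (proj1 (eq_sat_free _)) => v; rewrite (negPf (phi0 v)).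
Qed.

End SatFree.

Lemma equivalentP (V : vocabulary) (X : eqType) (phi : fo V X) (T : gra V) :
  sentence phi -> ar T = 0 ->
  (forall (M : model V) (s : X -> M), sat s phi <-> holds M T [::]) ->
  equivalent phi T.
Proof.
move=> phi0 T0 E M; apply: eq_adrel0 => //; split=> [H|H s]; last exact/E.
(* A nonempty domain provides an assignment at which to use [H]. *)
by have [a] := dom_nonempty M; apply/(E M (fun=> a)).
Qed.

(** Needed for suffix intersection, whose operands are read off a list that is already a suffix of
    the pair of variables. *)
Lemma drop_suffix (A : Type) (k m n : nat) (l : seq A) : k <= m -> m <= n ->
  drop (m - k) (drop (n - m) l) = drop (n - k) l.
Proof. by move=> km mn; rewrite drop_drop addnC addnBA ?subnK. Qed.

(** * From formulas to binary terms *)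

Section Translations.
Variable V : vocabulary.

(** Semantic conditions replace formulas, so that closure properties can be stated without syntax.
    One term must serve all models, and [true] is the variable in last position. *)
Definition definable (P : forall M : model V, (bool -> M) -> Prop) :=
  exists2 T : gra V, ar T = 2 &
    forall (M : model V) s, P M s <-> holds M T [:: s false; s true].

Lemma definable_ext (P Q : forall M : model V, (bool -> M) -> Prop) :
  (forall M s, Q M s <-> P M s) -> definable P -> definable Q.
Proof. by move=> PQ [T T2 HT]; exists T => // M s; rewrite PQ. Qed.

Lemma definable_not (P : forall M : model V, (bool -> M) -> Prop) :
  definable P -> definable (fun M s => ~ P M s).
Proof.
by move=> [T T2 HT]; exists (GNeg T) => // M s; rewrite HT member_neg_rel ?T2.
Qed.

Lemma definable_and (P Q : forall M : model V, (bool -> M) -> Prop) :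
  definable P -> definable Q -> definable (fun M s => P M s /\ Q M s).
Proof.
move=> [T T2 HT] [S S2 HS]; exists (GCap T S) => [|M s] /=; first by rewrite T2 S2.
rewrite member_suffix_cap /= ?T2 ?S2 // HT HS.
by rewrite [X in drop (2 - X)]T2 drop0 [X in drop (2 - X)]S2.
Qed.

Lemma definable_swap (P : forall M : model V, (bool -> M) -> Prop) :
  definable P -> definable (fun M s => P M (fun b => s (~~ b))).
Proof.
move=> [T T2 HT]; exists (GSwap T) => // M s.
by rewrite /= (@member_swap_rel _ _ _ [::]) ?T2 // HT.
Qed.

(** The full binary relation is the complement of equality intersected with its own complement. *)
Lemma definable_true : definable (fun M s => True).
Proof.
exists (GNeg (GCap GEq (GNeg GEq))) => // M s.
by rewrite member_neg_rel // member_suffix_cap //= member_neg_rel //; tauto.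
Qed.

(* Padding on the left: the full binary relation absorbs missing coordinates. *)
Lemma definable_suffix (U : gra V) : ar U <= 2 ->
  definable (fun M s => holds M U (drop (2 - ar U) [:: s false; s true])).
Proof.
move=> U2; have [T T2 HT] := definable_true.
have T2U : maxn (ar T) (ar U) = 2 by rewrite T2; apply/maxn_idPl.
exists (GCap T U) => // M s.
have dT : 2 - ar T = 0 by rewrite T2.
by rewrite member_suffix_cap //= dT drop0 -HT; tauto.
Qed.

(* The diagonal R(y, y) is the padding of the unary term [GEx (GCap GEq U)]. *)
Lemma definable_subst (U : gra V) (l : seq bool) : size l = ar U -> ar U <= 2 ->
  definable (fun M s => holds M U (map s l)).
Proof.
move=> sl U2; have dl : 2 - ar U = 2 - size l by rewrite sl.
(* The padded term handles suffixes ending in [s true], and its swap those ending in [s false]. This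
   covers every [l] without repetition. *)
have HU b : definable
    (fun M s => holds M U (drop (2 - size l) [:: s (~~ b); s b])).
  have HU := definable_suffix U2; rewrite dl in HU.
  by case: b; [|have := definable_swap HU].
case: l sl HU {dl} => [|b [|c [|? ?]]] sl HU; last by rewrite -sl in U2.
- exact: HU true.
- exact: HU b.
have [<-|bc] := eqVneq (~~ c) b.
  exact: HU c.
have {bc} -> : b = c by case: b c bc {sl HU} => -[].
have U2E : ar U = 2 by rewrite -sl.
have dU : 2 - ar U = 0 by rewrite U2E.
have cap2 : ar (GCap GEq U) = 2 by rewrite /= U2E.
pose D := GEx (GCap GEq U).
have D1 : ar D = 1 by rewrite /= U2E.
have capE (M : model V) a d :
    holds M (GCap GEq U) [:: a; d] <-> a = d /\ holds M U [:: a; d].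
  by rewrite member_suffix_cap ?[size _]/= ?dU ?drop0 ?(member_eq_rel a d) //.
have DE (M : model V) a : holds M D [:: a] <-> holds M U [:: a; a].
  rewrite (@member_proj_rel _ _ (gra_set M (GCap GEq U))) ?cap2 //.
  split=> [[d /capE[<-]] //|Ua].
  by exists a; apply/capE.
have dD : 2 - ar D = 1 by rewrite D1.
have HD := @definable_suffix D (leqW (eq_leq D1)).
have HDT : definable (fun M s => holds M U [:: s true; s true]).
  by apply: definable_ext HD => M s; rewrite dD DE.
by case: c {sl HU}; [|have := definable_swap HDT].
Qed.

(** Projection binds the last coordinate, that is [true]; for [false], swap before and after. The
    double swap returns an assignment only up to pointwise equality, whence the extensionality
    hypothesis. *)
Lemma definable_ex (v : bool) (P : forall M : model V, (bool -> M) -> Prop) :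
  (forall (M : model V) (s s' : bool -> M), s =1 s' -> P M s -> P M s') ->
  definable P -> definable (fun M s => exists a, P M (update s v a)).
Proof.
move=> Pext.
have ex_true (Q : forall M : model V, (bool -> M) -> Prop) :
   definable Q -> definable (fun M s => exists a, Q M (update s true a)).
  move=> [T T2 HT].
  have U1 : ar (GEx T) = 1 by rewrite /= T2.
  (* The projection is a unary term in the variable [false]; substitution makes it binary again. *)
  have := @definable_subst (GEx T) [:: false] (esym U1) (leqW (eq_leq U1)).
  apply: definable_ext => M s; rewrite (@member_proj_rel _ _ (gra_set M T)) ?T2 //.
  have Qa a : Q M (update s true a) <-> holds M T [:: s false; a] by rewrite HT.
  by split=> -[a Ha]; exists a; apply/Qa.
move=> HP; case: v; first exact: ex_true.
apply: definable_ext (definable_swap (ex_true _ (definable_swap HP))) => M s.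
by split=> -[a Ha]; exists a; apply: Pext Ha => -[].
Qed.

Lemma definable_sat (hV : forall R : V, arity R <= 2) (phi : FO2 V) :
  definable (fun M s => sat s phi).
Proof.
have ext (p : FO2 V) (M : model V) (s s' : bool -> M) :
    s =1 s' -> sat s p -> sat s' p.
  by move=> E; apply: (proj1 (eq_sat_free _)).
(* Disjunction, implication and the universal quantifier are reduced classically to the other
   connectives. *)
have or_def P Q : definable P -> definable Q ->
    definable (fun M s => P M s \/ Q M s).
  move=> /definable_not HP /definable_not HQ.
  apply: definable_ext (definable_not (definable_and HP HQ)) => M s.
  by have := EM (P M s); have := EM (Q M s); tauto.
elim: phi => [R t|v w|p IHp|p IHp q IHq|p IHp q IHq|p IHp q IHq|w p IHp|w p IHp].
- have := @definable_subst (GSym R) t (size_tuple t) (hV R).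
  by apply: definable_ext => M s; rewrite /= -(member_tval (interp M R)).
- have := @definable_subst GEq [:: v; w] erefl isT.
  by apply: definable_ext => M s; rewrite (member_eq_rel (s v)).
- exact: definable_not.
- exact: definable_and.
- exact: or_def.
- apply: definable_ext (or_def _ _ (definable_not IHp) IHq) => M s /=.
  by have := EM (sat s p); tauto.
- exact: definable_ex (ext p) IHp.
- have npext (M : model V) (s s' : bool -> M) : s =1 s' -> ~ sat s p -> ~ sat s' p.
    by move=> E np /(ext _ _ _ s) Hp; apply/np/Hp.
  apply: definable_ext (definable_not (definable_ex w npext (definable_not IHp))).
  by move=> M s /=; rewrite -forallNE; split=> H a; [move=> /(_ (H a))|apply: contrapT].
Qed.

(** * From terms to formulas *)

Lemma ar_le2 (hV : forall R : V, arity R <= 2) (T : gra V) : ar T <= 2.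
Proof.
elim: T => [R||T //|T //|T1 H1 T2 H2|T H] //=; first by rewrite geq_max H1.
exact: leq_trans (leq_pred _) H.
Qed.

(** Induction for both values of [b], the variable of the last coordinate, since swap and projection
    call on the other value. The bound on free variables yields a sentence at arity 0. *)
Lemma formula_of_term (hV : forall R : V, arity R <= 2) (T : gra V) (b : bool) :
  exists phi : FO2 V,
    (forall v, free v phi -> v \in drop (2 - ar T) [:: ~~ b; b]) /\
    (forall (M : model V) (s : bool -> M),
       sat s phi <-> holds M T (drop (2 - ar T) [:: s (~~ b); s b])).
Proof.
have T2 := ar_le2 hV.
elim: T b => [R||T IH|T IH|T1 IH1 S IH2|T IH] b.
- have sR : size (drop (2 - arity R) [:: ~~ b; b]) == arity R.
    by rewrite size_drop subKn.
  exists (FAtom R (Tuple sR)); split=> // M s.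
  by rewrite /= -(member_tval (interp M R)) /= map_drop.
- exists (FEq V (~~ b) b); split=> [v|M s]; first by rewrite /= !inE.
  by rewrite /= member_eq_rel.
- have [lt1|le1] := ltnP 1 (ar T).
    have E2 : ar T = 2 by apply/eqP; rewrite eqn_leq T2.
    have [phi [F H]] := IH (~~ b); exists phi; split=> [v /F|M s].
      by rewrite /= E2 !inE negbK orbC.
    have d0 : 2 - ar T = 0 by rewrite E2.
    by rewrite H /= d0 !drop0 (@member_swap_rel _ _ _ [::]) ?negbK.
  have [phi [F H]] := IH b; exists phi; split=> // M s.
  by rewrite H /= swap_rel_small.
- have [phi [F H]] := IH b; exists (FNot phi); split=> // M s.
  by rewrite /= H member_neg_rel // size_drop subKn.
- have [phi [F H]] := IH1 b; have [psi [G K]] := IH2 b.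
  have m2 := T2 (GCap T1 S); rewrite /= in m2.
  exists (FAnd phi psi); split=> [v|M s].
    have sub k : k <= maxn (ar T1) (ar S) -> v \in drop (2 - k) [:: ~~ b; b] ->
        v \in drop (2 - maxn (ar T1) (ar S)) [:: ~~ b; b].
      by move=> km; rewrite -(drop_suffix _ km m2); apply: mem_drop.
    by case/orP=> [/F|/G]; apply: sub; rewrite ?leq_maxl ?leq_maxr.
  have sm : size (drop (2 - maxn (ar T1) (ar S)) [:: s (~~ b); s b]) =
      maxn (ar T1) (ar S) by rewrite size_drop subKn.
  by rewrite /= H K member_suffix_cap // sm !drop_suffix ?leq_maxl ?leq_maxr.
(* With [~~ b] last and bound, what remains is a suffix ending in [b]. *)
- have [phi [F H]] := IH (~~ b); exists (FEx (~~ b) phi); split=> [v|M s].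
    rewrite /= => /andP[vb /F]; rewrite negbK.
    by case: (ar T) (T2 T) => [|[|[|]]] //= _; rewrite !inE (negPf vb) ?orbF.
  have sE a : holds M T (drop (2 - ar T) [:: s b; a]) <->
      sat (update s (~~ b) a) phi.
    by rewrite H negbK /update eqxx; case: b {F H}.
  (* At arity 0 projection is the identity and the quantifier is vacuous; [s b] is an arbitrary
     witness. *)
  have [T0|Tpos] := posnP (ar T).
    have d2 : 2 - (ar T).-1 = 2 - ar T by rewrite T0.
    have dE (c d : M) : drop (2 - ar T) [:: c; d] = [::] by rewrite T0.
    rewrite /= proj_rel0 // d2 dE.
    split=> [[a /sE]|Ts]; first by rewrite dE.
    by exists (s b); apply/sE; rewrite dE.
  rewrite /= member_proj_rel //.
  have rE a : rcons (drop (2 - (ar T).-1) [:: s (~~ b); s b]) a =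
      drop (2 - ar T) [:: s b; a].
    by case: (ar T) (T2 T) Tpos => [|[|[|]]].
  split=> -[a Ha]; exists a; first by rewrite rE; apply/sE.
  by apply/sE; rewrite -rE.
Qed.

End Translations.

Theorem theorem3p4 (V : vocabulary) (hV : forall R : V, arity R <= 2) :
  (forall phi : FO2 V, sentence phi ->
     exists T : gra V, equivalent phi T) /\
  (forall T : gra V, ar T = 0 ->
     exists phi : FO2 V, sentence phi /\ equivalent phi T).
Proof.
split=> [phi phi0|T T0].
  have [T T2 HT] := definable_sat hV phi.
  have U1 : ar (GEx T) = 1 by rewrite /= T2.
  (* Projecting twice quantifies both variables existentially, which does not change the truth value
     of a sentence. *)
  exists (GEx (GEx T)); apply: equivalentP => //= [|M s]; first by rewrite T2.
  have exE a : holds M (GEx T) [:: a] <-> exists c, holds M T [:: a; c].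
    by rewrite (@member_proj_rel _ _ (gra_set M T) [:: a]) ?T2.
  rewrite (@member_proj_rel _ _ (gra_set M (GEx T)) [::]) ?U1 //.
  split=> [Hs|[a /exE[c Hc]]].
    by exists (s false); apply/exE; exists (s true); apply/HT.
  by apply: (@sat_sentence _ _ _ _ (fun b => if b then c else a)) => //; apply/HT.
(* The choice of [true] is arbitrary: at arity 0 the suffix is empty. *)
have [phi [F H]] := formula_of_term hV T true.
have d2 : 2 - ar T = 2 by rewrite T0.
have phi0 : sentence phi by move=> v; apply/negP => /F; rewrite d2.
exists phi; split=> //; apply: equivalentP => // M s.
by rewrite H d2.
Qed.
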